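(* (1) Let $\mathbb{Z}\alpha$ be a rank-one positive-definite even lattice. Then the conic-type subVOA $V_C=V_{\mathbb{Z}_{\ge 0}\alpha}$ of the lattice VOA $V_{\mathbb{Z}\alpha}$ is $C_1$-cofinite. (2) Let $L=\mathbb{Z}\alpha\oplus\mathbb{Z}\beta$ be a rank-two positive-definite even lattice such that $(\alpha|\beta)=-n$, $(\beta|\beta)=2k$ and $(\alpha|\alpha)=2\ell$, with $n\ge 1$ and $k\ge \ell\ge 1$ integers. Suppose $n^2+\ell^2-4\ell k\le 0$. Then the conic-type subVOA $V_C=V_{\mathbb{Z}_{\ge 0}\alpha\oplus\mathbb{Z}_{\ge 0}\beta}$ of $V_L$ is $C_1$-cofinite.
   Context: Lattice VOA. For a positive-definite even lattice $L$ (form $(\cdot|\cdot)$ integer valued, $(\alpha|\alpha)\in 2\mathbb{Z}$) put $\mathfrak{h}=\mathbb{C}\otimes_{\mathbb{Z}}L$ with the $\mathbb{C}$-bilinear extension of $(\cdot|\cdot)$, and $\hat{\mathfrak{h}}=\mathfrak{h}\otimes\mathbb{C}[t,t^{-1}]\oplus\mathbb{C}K$ with $K$ central, $h(m)=h\otimes t^m$, $[h_1(m),h_2(n)]=m\delta_{m+n,0}(h_1|h_2)K$. For $\lambda\in\mathfrak{h}$, $M_{\hat{\mathfrak{h}}}(1,\lambda)=U(\hat{\mathfrak{h}})\otimes_{U(\hat{\mathfrak{h}}_{\ge 0})}\mathbb{C}e^\lambda$, where $\hat{\mathfrak{h}}_{\ge 0}=\mathfrak{h}\otimes\mathbb{C}[t]\oplus\mathbb{C}K$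 acts by $K=1$, $h(0)e^\lambda=(h|\lambda)e^\lambda$, $h(n)e^\lambda=0$ for $n>0$. Let $\epsilon:L\times L\to\{\pm1\}$ be a 2-cocycle with $\epsilon(\alpha,\beta)\epsilon(\beta,\alpha)=(-1)^{(\alpha|\beta)}$ and $\epsilon(0,\alpha)=\epsilon(\alpha,0)=1$. The lattice VOA is $V_L=\bigoplus_{\alpha\in L}M_{\hat{\mathfrak{h}}}(1,\alpha)=M_{\hat{\mathfrak{h}}}(1,0)\otimes\mathbb{C}^\epsilon[L]$ with vacuum $\mathbf{1}=e^0$, $Y(h(-1)\mathbf{1},z)=\sum_{n}h(n)z^{-n-1}$, $Y(e^\alpha,z)=\exp\big(\sum_{n>0}\frac{\alpha(-n)}{n}z^n\big)\exp\big(-\sum_{n>0}\frac{\alpha(n)}{n}z^{-n}\big)e_\alpha z^\alpha$, where $e_\alpha(w\otimes e^\beta)=\epsilon(\alpha,\beta)w\otimes e^{\alpha+\beta}$ and $z^\alpha$ acts on $M_{\hat{\mathfrak{h}}}(1,\beta)$ as $z^{(\alpha|\beta)}$; $Y$ of a general $h_1(-n_1-1)\cdots h_k(-n_k-1)e^\alpha$ is the normally ordered product of the $\frac{1}{n_i!}\partial_z^{n_i}h_i(z)$ and $Y(e^\alpha,z)$. The Virasoro element is $\omega=\frac12\sum_i u_i(-1)^2\mathbf{1}$ for an orthonormal basis $\{u_i\}$ of $\mathfrak{h}$; the weight of $h_1(-n_1)\cdots h_k(-n_k)e^\alpha$ is $n_1+\cdots+n_k+(\alpha|\alpha)/2$.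 For a submonoid $M\le L$ (a subset containing $0$ and closed under addition), $V_M=\bigoplus_{\gamma\in M}M_{\hat{\mathfrak{h}}}(1,\gamma)$, a subVOA of $V_L$ with the same vacuum and Virasoro element. A submonoid $C\le L$ is of conic-type if $C=\mathbb{Z}_{\ge 0}\alpha_1\oplus\cdots\oplus\mathbb{Z}_{\ge 0}\alpha_r$ for some $\mathbb{Z}$-basis $\{\alpha_1,\dots,\alpha_r\}$ of $L$; then $V_C$ is called a conic-type subVOA of $V_L$. A VOA $V$ is of CFT-type if $V=V_0\oplus V_+$ with $V_0=\mathbb{C}\mathbf{1}$, $V_+=\bigoplus_{n\ge 1}V_n$. For such $V$, writing $Y(a,z)=\sum_n a_nz^{-n-1}$, $C_1(V)=\mathrm{span}\{a_{-1}b: a,b\in V_+\}+\mathrm{span}\{L(-1)v: v\in V_+\}$, and $V$ is $C_1$-cofinite if $\dim V/C_1(V)<\infty$. *)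

(* Defs.v *)
From HB Require Import structures.
From mathcomp Require Import all_boot all_order all_algebra.
From mathcomp Require Import finmap multiset monalg.
From mathcomp Require Import boolp classical_sets cardinality fsbigop reals.
From mathcomp Require Import complex ring.

Set Implicit Arguments.
Unset Strict Implicit.
Unset Printing Implicit Defensive.

Import Order.TTheory GRing.Theory Num.Theory.
Local Open Scope mset_scope.
Local Open Scope classical_set_scope.
Local Open Scope ring_scope.

(** * Linear algebra of subsets of a vector space *)

Section Subspaces.
Variables (F : fieldType) (V : lmodType F).

Definition lspan (S : set V) : set V :=
  [set v | exists2 s : seq (F * V),
     (forall p, p \in s -> S p.2) & v = \sum_(p <- s) p.1 *: p.2].

Definition sumset (A B : set V) : set V := [set x + y | x in A & y in B].

(* [dim (W / U) < oo] for subspaces [U] of [W] *)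
Definition finite_codim (W U : set V) : Prop :=
  exists2 s : seq V, [set` s] `<=` W & W `<=` sumset (lspan [set` s]) U.

End Subspaces.

(** * Graded spaces with vertex operators, and C_1-cofiniteness *)

(* The data (not the axioms) of a vertex operator algebra realised on a
   subspace [vspc] of an ambient vector space: [vgr n] is the subspace of weight
   [n], [vmode a n] is the mode a_n in Y(a,z) = \sum_n a_n z^(-n-1), and [vconf]
   is the Virasoro element, so that L(-1) is its mode of index 0. *)
Record voa_data (F : fieldType) := VoaData {
  vcar  :> lmodType F;
  vspc  : set vcar;
  vgr   : int -> set vcar;
  vmode : vcar -> int -> vcar -> vcar;
  vvac  : vcar;
  vconf : vcar }.

Arguments vspc {F} v.
Arguments vgr {F} v n.
Arguments vmode {F v} a n w.
Arguments vvac {F} v.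
Arguments vconf {F} v.

Section C1.
Variables (F : fieldType) (X : voa_data F).

Definition vplus : set X := lspan (\bigcup_(n in [set n : int | 1 <= n]) vgr X n).

Definition CFT_type : Prop :=
  [/\ vgr X 0 = lspan [set vvac X],
      vspc X = sumset (vgr X 0) vplus &
      vgr X 0 `&` vplus = [set 0]].

Definition Lm1 (v : X) : X := vmode (vconf X) 0 v.

Definition C1 : set X :=
  sumset (lspan [set vmode a (-1) b | a in vplus & b in vplus])
         (lspan [set Lm1 v | v in vplus]).

Definition C1_cofinite : Prop := CFT_type /\ finite_codim (vspc X) C1.

End C1.

(** * Even lattices *)

Record evenLattice := EvenLattice {
  lat :> zmodType;
  lform : lat -> lat -> int;
  lformDl : forall x y z, lform (x + y) z = lform x z + lform y z;
  lformC : forall x y, lform x y = lform y x;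
  lform_even : forall x, (2 %| lform x x)%Z;
  lform_gt0 : forall x, x != 0 -> 0 < lform x x }.

Record zbasis (L : evenLattice) (r : nat) := ZBasis {
  zvec :> 'I_r -> L;
  zcoord : L -> 'I_r -> int;
  zcoordK : forall x, \sum_(i < r) zvec i *~ zcoord x i = x;
  zvecK : forall c i, zcoord (\sum_(j < r) zvec j *~ c j) i = c i }.

Definition cocycle (L : evenLattice) (eps : L -> L -> int) : Prop :=
  [/\ forall x y, eps x y = 1 \/ eps x y = -1,
      forall x y z, eps x y * eps (x + y) z = eps y z * eps x (y + z),
      forall x y, eps x y * eps y x = (-1) ^ lform x y &
      forall x, eps 0 x = 1 /\ eps x 0 = 1].

Definition conic (L : evenLattice) (r : nat) (b : zbasis L r) : set L :=
  [set x | exists n : 'I_r -> nat, x = \sum_(i < r) b i *+ n i].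

(** * Formal operations on operator-valued series *)

Section Series.
Variables (F : fieldType) (V : lmodType F).

(* [A : opser] stands for \sum_(k >= 0) A_k x^k *)
Definition opser := nat -> V -> V.

Definition ser1 : opser := fun k v => if k == 0%N then v else 0.

Definition sermul (A B : opser) : opser :=
  fun k v => \sum_(i < k.+1) A i (B (k - i)%N v).

(* [\sum_j A^j / j!], for [A] without constant term: the powers with [j > k] do
   not contribute to the coefficient of x^k. *)
Definition serexp (A : opser) : opser :=
  fun k v => \sum_(j < k.+1) (j`!%:R)^-1 *: iter j (sermul A) ser1 k v.

(* [A : opfield] stands for \sum_(n : int) A_n z^(-n-1) *)
Definition opfield := int -> V -> V.

Definition dfield (A : opfield) : opfield := fun n v => - (n%:~R *: A (n - 1) v).

Definition ddfield (k : nat) (A : opfield) : opfield :=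
  fun n v => (k`!%:R)^-1 *: iter k dfield A n v.

(* The normally ordered product A(z)_- B(z) + B(z) A(z)_+, where A(z)_+ collects
   the modes A_n with [n >= 0].  Both sums have finite support on every vector
   as soon as A_n v = B_n v = 0 for [n] large; sums over [set: nat] are 0 by
   convention when the support is infinite. *)
Definition nop (A B : opfield) : opfield := fun n v =>
  \sum_(j \in [set: nat]) A (- j%:Z - 1) (B (n + j%:Z) v) +
  \sum_(j \in [set: nat]) B (n - 1 - j%:Z) (A j%:Z v).

End Series.

(** * The lattice vertex operator algebra *)

(* [Fock S x] labels the vector b_i1(-m1-1) ... b_ik(-mk-1) e^x, where [S] is the
   multiset of the pairs (i1, m1), ..., (ik, mk) and b_1, ..., b_r is a fixed
   basis of the Cartan space.  By the Poincare-Birkhoff-Witt theorem these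
   vectors, for fixed [x], form a basis of the induced module M(1, x); see
   [heis_creation], [heis_bracket], [heis_e0] and [heis_epos] below. *)
Record fock_label (L : evenLattice) (r : nat) := Fock {
  fmodes : {mset 'I_r * nat};
  fbase : L }.

(* Classical rather than computable instances, so that unification in the free
   vector space below does not try to evaluate comparisons of labels. *)
HB.instance Definition _ L r := gen_eqMixin (fock_label L r).
HB.instance Definition _ L r := gen_choiceMixin (fock_label L r).

Section LatticeVOA.
Variables (F : fieldType) (L : evenLattice) (r : nat) (b : zbasis L r).

(* The Cartan space [F \otimes L], in coordinates in the basis [b]. *)
Definition cartan := 'rV[F]_r.

Definition hlat (x : L) : cartan := \row_i (zcoord b x i)%:~R.

Definition hvec (i : 'I_r) : cartan := delta_mx 0 i.

Definition hform (h k : cartan) : F :=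
  \sum_(i < r) \sum_(j < r) h 0 i * k 0 j * (lform (b i) (b j))%:~R.

Definition orthonormal_basis (u : 'I_r -> cartan) : Prop :=
  forall i j, hform (u i) (u j) = (i == j)%:R.

Local Notation label := (fock_label L r).

Definition VL : lmodType F := {malg F[label]}.

Definition bvec (k : label) : VL := << k >>.

Definition e_ (x : L) : VL := bvec (Fock mset0 x).

Definition linext (f : label -> VL) (v : VL) : VL :=
  \sum_(k <- msupp v) v@_k *: f k.

(* [heis h n] is h(n).  [Negz m] is the integer -(m+1).  Annihilation operators
   act as derivations: h(m) sends b_j(-m) to m (h | b_j). *)
Definition heis (h : cartan) (n : int) : VL -> VL := linext (fun k =>
  match n with
  | Negz m => \sum_(i < r) h 0 i *: bvec (Fock ((i, m) +` fmodes k)%mset (fbase k))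
  | Posz 0 => hform h (hlat (fbase k)) *: bvec k
  | Posz m.+1 => \sum_(j < r)
      (m.+1%:R * hform h (hvec j) * (fmodes k (j, m))%:R) *:
      bvec (Fock (fmodes k `\ (j, m))%mset (fbase k))
  end).

Lemma linextE (f : label -> VL) (d : {fset label}) (v : VL) :
  (msupp v `<=` d)%fset -> linext f v = \sum_(k <- d) v@_k *: f k.
Proof.
move=> vd; apply: big_fset_incl => // k _ kv.
by rewrite mcoeff_outdom ?scale0r.
Qed.

Lemma linext_is_linear f : linear (linext f).
Proof.
move=> c v w; pose d := (msupp v `|` msupp w `|` msupp (c *: v + w))%fset.
rewrite !(@linextE _ d); last 3 first.
- by rewrite /d fsubsetU// fsubsetUr.
- by rewrite /d fsubsetU// fsubsetUl.
- by rewrite /d fsubsetUr.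
rewrite scaler_sumr -big_split /=; apply: eq_bigr => k _.
by rewrite mcoeffD mcoeffZ scalerDl scalerA.
Qed.

HB.instance Definition _ f :=
  GRing.isLinear.Build F VL VL _ (linext f) (linext_is_linear f).

Lemma linext_bvec f k : linext f (bvec k) = f k.
Proof.
by rewrite (@linextE _ [fset k]%fset) ?msuppU_le// big_seq_fset1 mcoeffUU scale1r.
Qed.

HB.instance Definition _ h n := GRing.Linear.on (heis h n).

Lemma bvecE (v : VL) : v = \sum_(k <- msupp v) v@_k *: bvec k.
Proof.
rewrite [LHS]monalgE; apply: eq_bigr => k _; apply/malgP => k'.
by rewrite mcoeffZ [in LHS]mcoeffU [X in _ * X]mcoeffU mulrnAr mulr1.
Qed.

Lemma hformDl c h h' k : hform (c *: h + h') k = c * hform h k + hform h' k.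
Proof.
rewrite mulr_sumr -big_split; apply: eq_bigr => i _ /=.
rewrite mulr_sumr -big_split; apply: eq_bigr => j _ /=.
by rewrite !mxE !mulrDl !mulrA.
Qed.

Lemma hformC h k : hform h k = hform k h.
Proof.
rewrite /hform exchange_big; apply: eq_bigr => i _; apply: eq_bigr => j _ /=.
by rewrite lformC [h 0 j * _]mulrC.
Qed.

Lemma hform_sumr h k : hform h k = \sum_(i < r) k 0 i * hform h (hvec i).
Proof.
rewrite {1}/hform exchange_big; apply: eq_bigr => j _ /=.
rewrite /hform mulr_sumr; apply: eq_bigr => i _ /=.
rewrite (bigD1 j)//= big1 ?addr0 => [|j' /negPf jj'].
  by rewrite !mxE !eqxx mulr1 mulrCA mulrA.
by rewrite !mxE eqxx jj' mulr0 mul0r.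
Qed.

Lemma heis_creation (i : 'I_r) (m : nat) (k : label) :
  heis (hvec i) (Negz m) (bvec k) = bvec (Fock ((i, m) +` fmodes k)%mset (fbase k)).
Proof.
rewrite /heis linext_bvec (bigD1 i)//= big1 ?addr0 => [|j /negPf ji].
  by rewrite !mxE !eqxx scale1r.
by rewrite !mxE ji andbF scale0r.
Qed.

Lemma heis_e0 (h : cartan) (x : L) : heis h 0 (e_ x) = hform h (hlat x) *: e_ x.
Proof. exact: linext_bvec. Qed.

Lemma heis_epos (h : cartan) (m : nat) (x : L) : heis h m.+1 (e_ x) = 0.
Proof.
by rewrite /heis linext_bvec big1// => j _; rewrite mset0E mulr0 scale0r.
Qed.

Let brk h k (m n : int) : F := if m + n == 0 then m%:~R * hform h k else 0.

Let brkC h k m n : brk k h n m = - brk h k m n.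
Proof.
rewrite /brk (addrC n m) (hformC k h); case: eqP => [/eqP|]; last by rewrite oppr0.
by rewrite addr_eq0 => /eqP ->; rewrite mulrNz mulNr opprK.
Qed.

Let heisZ h n c w : heis h n (c *: w) = c *: heis h n w.
Proof. exact: linearZ. Qed.

Let heis_sum h n (I : Type) (s : seq I) (f : I -> VL) :
  heis h n (\sum_(i <- s) f i) = \sum_(i <- s) heis h n (f i).
Proof. exact: linear_sum. Qed.

Let negE h m S x : heis h (Negz m) (bvec (Fock S x)) =
  \sum_(i < r) h 0 i *: bvec (Fock ((i, m) +` S)%mset x).
Proof. exact: linext_bvec. Qed.

Let zeroE h S x : heis h 0 (bvec (Fock S x)) = hform h (hlat x) *: bvec (Fock S x).
Proof. exact: linext_bvec. Qed.

Let posE h (m : nat) S x : heis h m.+1 (bvec (Fock S x)) =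
  \sum_(j < r) (m.+1%:R * hform h (hvec j) * (S (j, m))%:R) *:
     bvec (Fock (S `\ (j, m))%mset x).
Proof. exact: linext_bvec. Qed.

Let negZE c h m S x : heis h (Negz m) (c *: bvec (Fock S x)) =
  \sum_(i < r) (c * h 0 i) *: bvec (Fock ((i, m) +` S)%mset x).
Proof.
by rewrite heisZ negE scaler_sumr; apply: eq_bigr => i _; rewrite scalerA.
Qed.

Let posZE c h (m : nat) S x : heis h m.+1 (c *: bvec (Fock S x)) =
  \sum_(j < r) (c * (m.+1%:R * hform h (hvec j) * (S (j, m))%:R)) *:
     bvec (Fock (S `\ (j, m))%mset x).
Proof.
by rewrite heisZ posE scaler_sumr; apply: eq_bigr => i _; rewrite scalerA.
Qed.

Let posposE h k (m n : nat) S x : heis h m.+1 (heis k n.+1 (bvec (Fock S x))) =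
  \sum_(j < r) \sum_(i < r)
    (n.+1%:R * hform k (hvec j) * (S (j, n))%:R *
     (m.+1%:R * hform h (hvec i) * ((S `\ (j, n))%mset (i, m))%:R)) *:
     bvec (Fock (S `\ (j, n) `\ (i, m))%mset x).
Proof. by rewrite posE heis_sum; apply: eq_bigr => j _; exact: posZE. Qed.

Let posnegE h k (m n : nat) S x : heis h m.+1 (heis k (Negz n) (bvec (Fock S x))) =
  \sum_(i < r) \sum_(j < r)
    (k 0 i * (m.+1%:R * hform h (hvec j) * (((i, n) +` S)%mset (j, m))%:R)) *:
     bvec (Fock (((i, n) +` S) `\ (j, m))%mset x).
Proof. by rewrite negE heis_sum; apply: eq_bigr => j _; exact: posZE. Qed.

Let negposE h k (m n : nat) S x : heis k (Negz n) (heis h m.+1 (bvec (Fock S x))) =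
  \sum_(j < r) \sum_(i < r)
    (m.+1%:R * hform h (hvec j) * (S (j, m))%:R * k 0 i) *:
     bvec (Fock ((i, n) +` (S `\ (j, m)))%mset x).
Proof. by rewrite posE heis_sum; apply: eq_bigr => j _; exact: negZE. Qed.

Let negnegE h k (m n : nat) S x : heis h (Negz m) (heis k (Negz n) (bvec (Fock S x))) =
  \sum_(j < r) \sum_(i < r)
    (k 0 j * h 0 i) *: bvec (Fock ((i, m) +` ((j, n) +` S))%mset x).
Proof. by rewrite negE heis_sum; apply: eq_bigr => j _; exact: negZE. Qed.

Let sum2B (V : zmodType) (f g : 'I_r -> 'I_r -> V) :
  \sum_i \sum_j f i j - \sum_j \sum_i g j i = \sum_i \sum_j (f i j - g j i).
Proof.
by rewrite [X in _ - X]exchange_big -sumrB; apply: eq_bigr => i _; rewrite sumrB.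
Qed.

Let heis_bracket_bvec h k m n (s : label) : n <= m ->
  heis h m (heis k n (bvec s)) - heis k n (heis h m (bvec s)) =
  brk h k m n *: bvec s.
Proof.
case: s => S x.
case: m n => [[|m]|m] [[|n]|n] // mn.
- by rewrite !zeroE !heisZ !zeroE !scalerA mulrC subrr /brk mul0r scale0r.
- rewrite /brk scale0r zeroE heisZ negE heis_sum scaler_sumr -sumrB big1// => i _.
  by rewrite heisZ zeroE !scalerA mulrC subrr.
- rewrite /brk scale0r zeroE heisZ posE heis_sum scaler_sumr -sumrB big1// => i _.
  by rewrite heisZ zeroE !scalerA mulrC subrr.
- rewrite posposE posposE sum2B /brk scale0r.
  apply: big1 => i _; apply: big1 => j _.
  rewrite (_ : (S `\ (j, m) `\ (i, n) = S `\ (i, n) `\ (j, m))%mset); last first.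
    by apply/msetP => z; rewrite !msetB1E subnAC.
  rewrite -scalerBl; move: (bvec _) => w; rewrite !msetB1E.
  rewrite (eq_sym (i, n) (j, m)); set e := _ == _.
  rewrite (_ : _ - _ = 0) ?scale0r//; apply/eqP; rewrite subr_eq0; apply/eqP.
  rewrite {}/e; case: eqP => [[-> ->]|_]; last by rewrite !subn0; ring.
  by ring.
- rewrite posnegE negposE sum2B.
  transitivity (\sum_(i < r) \sum_(j < r)
      (if (i == j) && (n == m) then k 0 i * (m.+1%:R * hform h (hvec j)) else 0)
        *: bvec (Fock S x)).
    apply: eq_bigr => i _; apply: eq_bigr => j _.
    case: (boolP ((i == j) && (n == m))) => [/andP[/eqP-> /eqP->]|ijnm].
      rewrite msetD1K mset1DE eqxx.
      have [S0|S0] := posnP (S (j, m)).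
        by rewrite S0 addn0 !(mulr0, mul0r) scale0r subr0 mulr1.
      rewrite msetB1K; last by rewrite in_mset.
      by rewrite -scalerBl add1n -natr1; congr (_ *: _); ring.
    have ne : ((j, m) == (i, n)) = false.
      by apply/negbTE; rewrite xpair_eqE eq_sym [m == n]eq_sym.
    rewrite mset1DE ne add0n.
    rewrite (_ : (((i, n) +` S) `\ (j, m)) = ((i, n) +` (S `\ (j, m))%mset))%mset.
      rewrite -scalerBl [RHS]scale0r (_ : _ - _ = 0) ?scale0r//; ring.
    apply/msetP => z; rewrite !(msetB1E, mset1DE).
    by have [->|] := eqVneq z (i, n); rewrite ?[(i, n) == _]eq_sym ?ne ?subn0 ?addnA.
  under eq_bigr do rewrite -scaler_suml.
  rewrite -scaler_suml; congr (_ *: _).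
  rewrite /brk NegzE subr_eq0 eqz_nat eqSS.
  rewrite (eq_sym m n); have [_|_] := eqVneq n m; last first.
    by apply: big1 => i _; apply: big1 => j _; rewrite andbF.
  rewrite [in RHS]hform_sumr mulr_sumr; apply: eq_bigr => i _.
  rewrite (bigD1 i)//= eqxx big1 ?addr0; first by rewrite mulrCA.
  by move=> j /negbTE; rewrite eq_sym => ->.
- rewrite negnegE negnegE sum2B /brk scale0r.
  apply: big1 => i _; apply: big1 => j _.
  rewrite mulrC msetDCA; exact: subrr.
Qed.

Lemma heis_bracket (h k : cartan) (m n : int) (v : VL) :
  heis h m (heis k n v) - heis k n (heis h m v) =
  (if m + n == 0 then m%:~R * hform h k else 0) *: v.
Proof.
rewrite -/(brk h k m n).
move: (msupp v : seq _) (fun s => mcoeff s v) (bvecE v) => ss c ->.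
rewrite (heis_sum k) (heis_sum h) (heis_sum h m) (heis_sum k n).
rewrite -sumrB scaler_sumr; apply: eq_bigr => s _.
rewrite !heisZ -scalerBr [RHS]scalerA mulrC -scalerA.
suff -> : heis h m (heis k n (bvec s)) - heis k n (heis h m (bvec s)) =
  brk h k m n *: bvec s by [].
have [nm|/ltW mn] := lerP n m; first exact: heis_bracket_bvec.
by rewrite -[LHS]opprB heis_bracket_bvec// brkC scaleNr opprK.
Qed.

Variable eps : L -> L -> int.

Definition eop (x : L) : VL -> VL :=
  linext (fun k => (eps x (fbase k))%:~R *: bvec (Fock (fmodes k) (x + fbase k))).

(* The coefficient of z^s in the operator z^x. *)
Definition zop (x : L) (s : int) : VL -> VL :=
  linext (fun k => if lform x (fbase k) == s then bvec k else 0).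

(* exp(\sum_(n > 0) x(-n)/n z^n), as a series in z *)
Definition Eminus (x : L) : opser VL :=
  serexp (fun n v =>
    if n == 0%N then 0 else n%:R^-1 *: heis (hlat x) (- n%:Z) v).

(* exp(- \sum_(n > 0) x(n)/n z^(-n)), as a series in z^-1 *)
Definition Eplus (x : L) : opser VL :=
  serexp (fun n v =>
    if n == 0%N then 0 else - (n%:R^-1 *: heis (hlat x) n%:Z v)).

(* The coefficient of z^(-n-1) in Eminus Eplus e_x z^x: the factors contribute
   z^p, z^(-q) and z^s with p - q + s = -n-1.  On each vector only finitely many
   pairs (p, q) contribute. *)
Definition Ye (x : L) : opfield VL := fun n v =>
  \sum_(t \in [set: nat * nat])
    Eminus x t.1 (Eplus x t.2 (eop x (zop x (- n - 1 - t.1%:Z + t.2%:Z) v))).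

(* The iterated normally ordered product does not depend on the order in which
   the multiset [fmodes k] is enumerated. *)
Definition Yfock (k : label) : opfield VL :=
  foldr (fun p B => nop (ddfield p.2 (heis (hvec p.1))) B) (Ye (fbase k))
        (fmodes k : seq ('I_r * nat)).

Definition Ymode (a : VL) (n : int) (v : VL) : VL :=
  \sum_(k <- msupp a) a@_k *: Yfock k n v.

Definition wt (k : label) : int :=
  (\sum_(p <- (fmodes k : seq ('I_r * nat))) p.2.+1)%N%:Z +
  (lform (fbase k) (fbase k) %/ 2)%Z.

Definition omega (u : 'I_r -> cartan) : VL :=
  2%:R^-1 *: \sum_(i < r) heis (u i) (-1) (heis (u i) (-1) (e_ 0)).

Definition VM (M : set L) : set VL :=
  [set v | forall k, k \in msupp v -> M (fbase k)].

(* The subalgebra V_M, for a submonoid [M] of [L]; [u] is an orthonormal basis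
   of the Cartan space. *)
Definition lattice_subVOA (u : 'I_r -> cartan) (M : set L) : voa_data F :=
  {| vcar := VL;
     vspc := VM M;
     vgr := fun n => [set v | VM M v /\ forall k, k \in msupp v -> wt k = n];
     vmode := Ymode;
     vvac := e_ 0;
     vconf := omega u |}.

End LatticeVOA.

(* Main.v *)
Require Import Defs.
From HB Require Import structures.
From mathcomp Require Import all_boot all_order all_algebra.
From mathcomp Require Import finmap multiset monalg.
From mathcomp Require Import boolp classical_sets fsbigop reals complex.
From mathcomp Require Import zify ring.

Set Implicit Arguments.
Unset Strict Implicit.
Unset Printing Implicit Defensive.

Import Order.TTheory GRing.Theory Num.Theory.
Local Open Scope classical_set_scope.
Local Open Scope ring_scope.

(** Write [C] for the conic monoid.  Modulo [C_1(V_C)] almost every Fock basis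
    vector vanishes, for three reasons.

    - [b_i(-m-1)w = (b_i(-m-1)1)_(-1) w], so a vector with at least one creation
      mode is in [C_1] as soon as what remains after removing that mode is not the
      vacuum ([C1_heis]).
    - [b_i(-m-2)1] is a multiple of [L(-1) b_i(-m-1)1] ([Lm1_heis],
      [C1_heis_vac]), which leaves only the [b_i(-1)1] in charge 0.
    - If [x] and [y] are nonzero elements of [C] with [(x|y) >= 0] then
      [e^(x+y)] is in [C_1] ([C1_e_add]).  The product [Y(e^x,z) e^y] starts
      with [+-e^(x+y) z^(x|y)]; for [s = (x|y) > 0] one replaces [e^x] by
      [b_i(-s)e^x], whose field has the extra factor
      [1/(s-1)! \partial^(s-1) b_i(z)], and on [e^y] the zero mode of [b_i] gives
      it a pole of order exactly [s], with coefficient [+-(b_i|y)].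

    Hence [V_C] is C_1-cofinite whenever all but finitely many elements of [C] are
    sums of two nonzero elements of [C] with nonnegative product
    ([C1_cofinite_of_decomposition]).  In rank one, [m a = a + (m-1) a] will do.  In
    rank two, split [z] into two halves [x] and [y], rounding the coordinates
    down and up: [4 (x|y) = (z|z) - (x-y|x-y)], where [x-y] takes only four values
    and [(z|z)] tends to infinity because the form is positive definite.  In the
    theorem, [n^2 + l^2 <= 4lk] makes the discriminant [4lk - n^2] positive. *)

(** * Subspaces given as sets *)

Section SubspaceTheory.
Variables (F : fieldType) (V : lmodType F).

Definition subspace (S : set V) : Prop :=
  S 0 /\ forall c x y, S x -> S y -> S (c *: x + y).

Lemma subspaceZ (S : set V) c x : subspace S -> S x -> S (c *: x).
Proof. by case=> S0 SP Sx; rewrite -[_ *: _]addr0; apply: SP. Qed.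

Lemma subspaceD (S : set V) x y : subspace S -> S x -> S y -> S (x + y).
Proof. by case=> S0 SP Sx Sy; rewrite -[x]scale1r; apply: SP. Qed.

Lemma subspace_sum (S : set V) (I : eqType) (s : seq I) (f : I -> V) :
  subspace S -> (forall i, i \in s -> S (f i)) -> S (\sum_(i <- s) f i).
Proof.
move=> SP Sf; rewrite big_seq; elim/big_ind: _ => //; first by case: SP.
by move=> x y; exact: subspaceD.
Qed.

Lemma sub_lspan (S : set V) : S `<=` lspan S.
Proof.
move=> v Sv; exists [:: (1, v)]; last by rewrite big_seq1 scale1r.
by move=> p; rewrite inE => /eqP ->.
Qed.

Lemma lspan_subspace (S : set V) : subspace (lspan S).
Proof.
split; first by exists [::]; rewrite ?big_nil.
move=> c _ _ [s sS ->] [t tS ->].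
exists ([seq (c * p.1, p.2) | p <- s] ++ t) => [p|].
  by rewrite mem_cat => /orP[/mapP[q /sS Sq ->]|/tS].
rewrite big_cat big_map scaler_sumr; congr (_ + _).
by apply: eq_bigr => p _; rewrite scalerA.
Qed.

Lemma lspan_min (S T : set V) : subspace T -> S `<=` T -> lspan S `<=` T.
Proof.
move=> TP ST _ [s sS ->]; apply: subspace_sum => // p /sS /ST.
exact: subspaceZ.
Qed.

Lemma sumset_subspace (A B : set V) :
  subspace A -> subspace B -> subspace (sumset A B).
Proof.
move=> [A0 AP] [B0 BP]; split; first by exists 0 => //; exists 0; rewrite ?addr0.
move=> c _ _ [x Ax [y By <-]] [z Az [t Bt <-]].
exists (c *: x + z); first exact: AP.
by exists (c *: y + t); [exact: BP | rewrite scalerDr addrACA].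
Qed.

Lemma sub_sumsetl (A B : set V) : B 0 -> A `<=` sumset A B.
Proof. by move=> B0 x Ax; exists x => //; exists 0; rewrite ?addr0. Qed.

Lemma sub_sumsetr (A B : set V) : A 0 -> B `<=` sumset A B.
Proof. by move=> A0 x Bx; exists 0 => //; exists x; rewrite ?add0r. Qed.

End SubspaceTheory.

(** * Formal series of operators *)

Lemma fsum_single (T : choiceType) (V : nmodType) (f : T -> V) (t0 : T) :
  (forall t, t != t0 -> f t = 0) -> \sum_(t \in [set: T]) f t = f t0.
Proof.
move=> f0; rewrite (@fsbigTE _ _ _ _ [fset t0]%fset) ?big_seq_fset1// => t.
by rewrite inE; exact: f0.
Qed.

Lemma fsum0 (T : choiceType) (V : nmodType) (f : T -> V) :
  (forall t, f t = 0) -> \sum_(t \in [set: T]) f t = 0.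
Proof. by move=> f0; apply: fsbig1. Qed.

Section SeriesTheory.
Variables (F : numFieldType) (V : lmodType F).
Implicit Types (A B : opfield V).

(** On a vector killed by all the coefficients, only the power of exponent 0
    contributes to the exponential. *)
Lemma serexp_ann (A : opser V) k v :
  (forall i, A i 0 = 0) -> (forall i, A i v = 0) -> serexp A k v = ser1 k v.
Proof.
move=> A0 Av.
have powE j : iter j (sermul A) (@ser1 _ V) k v = if j == 0%N then ser1 k v else 0.
  elim: j k => [|j IHj] k //=; apply: big1 => i _; rewrite IHj /ser1.
  by case: ifP => // _; case: ifP.
rewrite /serexp (bigD1 ord0)//= fact0 invr1 scale1r big1 ?addr0// => i i0.
by rewrite powE -val_eqE /= in i0 *; rewrite (negbTE i0) scaler0.
Qed.

Lemma serexp0E (A : opser V) v : serexp A 0 v = v.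
Proof. by rewrite /serexp big_ord1 fact0 invr1 scale1r. Qed.

Lemma iter_dfield_neg A m j v :
  iter m (@dfield _ V) A (Negz j) v = ((m + j) ^_ m)%:R *: A (Negz (m + j)) v.
Proof.
elim: m j => [|m IHm] j; first by rewrite ffactn0 scale1r.
rewrite iterS /dfield (_ : Negz j - 1 = Negz j.+1); last by lia.
rewrite IHm addnS addSn scalerA -scaleNr; congr (_ *: _).
rewrite ffactnSr natrM mulrC -mulrN; congr (_ * _).
by rewrite NegzE mulrNz opprK -addnS addKn.
Qed.

Lemma iter_dfield_pos A m j v :
  iter m (@dfield _ V) A (Posz j) v =
    ((-1) ^+ m * (j ^_ m)%:R) *: A (j%:Z - m%:Z) v.
Proof.
elim: m j => [|m IHm] j; first by rewrite ffactn0 mulr1 scale1r subr0.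
rewrite iterS /dfield; case: j => [|j].
  by rewrite scale0r oppr0 ffact0n mulr0 scale0r.
rewrite (_ : j.+1%:Z - 1 = j); last by lia.
rewrite IHm scalerA -scaleNr (_ : j%:Z - m%:Z = j.+1%:Z - m.+1%:Z); last by lia.
by congr (_ *: _); rewrite ffactSS natrM exprS; ring.
Qed.

Let fact_neq0 m : m`!%:R != 0 :> F.
Proof. by rewrite pnatr_eq0 -lt0n fact_gt0. Qed.

Lemma ddfield_m1 A m v : ddfield m A (-1) v = A (Negz m) v.
Proof.
rewrite /ddfield (_ : -1 = Negz 0)// iter_dfield_neg addn0 ffactnn.
by rewrite scalerA mulVf ?scale1r.
Qed.

(** The binomial coefficient is what truncates the sums below: it vanishes for
    [j < m]; for [j > m] and a Heisenberg field [A], the mode [A_(j-m)] is an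
    annihilation operator. *)
Lemma ddfield_pos A m j v :
  ddfield m A (Posz j) v = ((-1) ^+ m * 'C(j, m)%:R) *: A (j%:Z - m%:Z) v.
Proof.
rewrite /ddfield iter_dfield_pos scalerA -bin_ffact natrM; congr (_ *: _).
by rewrite [X in _ * X]mulrA mulrC mulfK.
Qed.

(** The field of the vacuum vector. *)
Definition idfield : opfield V := fun n v => if n == -1 then v else 0.

(** In the normally ordered product with the identity field, [A_n] comes from the
    first sum for [n < 0] and from the second one for [n >= 0]. *)
Lemma nop_idfield A B n v : (forall j, A j 0 = 0) ->
  (forall j w, B j w = idfield j w) -> nop A B n v = A n v.
Proof.
move=> A0 BE; rewrite /nop.
case: n => j; last first.
  rewrite [X in _ + X]fsum0 => [|i]; last first.
    by rewrite BE /idfield ifF//; apply/eqP; lia.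
  rewrite (@fsum_single _ _ _ j) => [|i /eqP ij].
    rewrite BE /idfield ifT ?addr0; last by apply/eqP; lia.
    by congr A; lia.
  by rewrite BE /idfield ifF ?A0//; apply/eqP; lia.
rewrite fsum0 => [|i]; last first.
  by rewrite BE /idfield; case: eqP => [|_]; [lia | exact: A0].
rewrite (@fsum_single _ _ _ j) => [|i /eqP ij].
  by rewrite BE add0r /idfield; case: eqP => //; lia.
by rewrite BE /idfield; case: eqP => //; lia.
Qed.

End SeriesTheory.

(** * The modes of the lattice vertex algebra *)

Section LatticeForm.
Variable L : evenLattice.
Implicit Types x y z : L.

Lemma lformMnl x y m : lform (x *+ m) y = lform x y *+ m.
Proof.
elim: m => [|m IHm]; last by rewrite !mulrS lformDl IHm.
by apply: (addrI (lform 0 y)); rewrite -lformDl !mulr0n !addr0.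
Qed.

Lemma lformDr x y z : lform x (y + z) = lform x y + lform x z.
Proof. by rewrite lformC lformDl !(lformC _ x). Qed.

Lemma lformMnr x y m : lform x (y *+ m) = lform x y *+ m.
Proof. by rewrite lformC lformMnl lformC. Qed.

Lemma lform0l y : lform 0 y = 0.
Proof. by have := lformMnl 0 y 0; rewrite !mulr0n. Qed.

Lemma lformNl x y : lform (- x) y = - lform x y.
Proof. by apply/eqP; rewrite -addr_eq0 -lformDl addNr lform0l. Qed.

Lemma lformMzl x y m : lform (x *~ m) y = lform x y *~ m.
Proof.
case: m => m; first exact: lformMnl.
by rewrite NegzE !mulrNz lformNl; congr (- _); exact: lformMnl.
Qed.

Lemma lformMzr x y m : lform x (y *~ m) = lform x y *~ m.
Proof. by rewrite lformC lformMzl lformC. Qed.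

Lemma lform_suml (I : Type) (s : seq I) (f : I -> L) y :
  lform (\sum_(i <- s) f i) y = \sum_(i <- s) lform (f i) y.
Proof.
elim: s => [|i s IHs]; first by rewrite !big_nil lform0l.
by rewrite !big_cons lformDl IHs.
Qed.

Lemma lform_sumr (I : Type) (s : seq I) (f : I -> L) y :
  lform y (\sum_(i <- s) f i) = \sum_(i <- s) lform y (f i).
Proof. by rewrite lformC lform_suml; apply: eq_bigr => i _; rewrite lformC. Qed.

End LatticeForm.

Section LatticeModes.
Variables (F : numFieldType) (L : evenLattice) (r : nat) (b : zbasis L r).
Variables (eps : L -> L -> int) (epsP : cocycle eps).
Local Notation V := (VL F L r).
Local Notation vac := (e_ F r (0 : L)).
Implicit Types (x y : L) (v w : V) (i j : 'I_r) (m : nat).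

Lemma hlat0 : hlat F b 0 = 0.
Proof.
have c0 i : zcoord b 0 i = 0.
  by rewrite -(zvecK b (fun=> 0) i); congr zcoord; rewrite big1// => j _; rewrite mulr0z.
by apply/rowP => i; rewrite !mxE c0.
Qed.

Lemma hform_hvecE i (h : cartan F r) :
  hform b (hvec F i) h = \sum_j h 0 j * (lform (b i) (b j))%:~R.
Proof.
rewrite /hform (bigD1 i)//= [X in _ + X]big1 ?addr0 => [|i' /negPf ii'].
  by apply: eq_bigr => j _; rewrite !mxE !eqxx mul1r.
by apply: big1 => j _; rewrite !mxE ii' andbF !mul0r.
Qed.

Lemma hform_hvec_hlat i x :
  hform b (hvec F i) (hlat F b x) = (lform (b i) x)%:~R.
Proof.
rewrite hform_hvecE -{2}(zcoordK b x) lform_sumr rmorph_sum; apply: eq_bigr => j _.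
by rewrite mxE lformMzr /= mulrzz intrM mulrC.
Qed.

Lemma heis_lin0 (h : cartan F r) n : heis b h n (0 : V) = 0.
Proof. exact: linear0. Qed.

Lemma hform0l (h : cartan F r) : hform b 0 h = 0.
Proof. by apply: big1 => i _; apply: big1 => j _; rewrite mxE !mul0r. Qed.

Lemma heis_hlat0 n v : heis b (hlat F b 0) n v = 0.
Proof.
rewrite /heis /linext big1// => k _; rewrite hlat0.
case: n => [[|m]|m]; first by rewrite hform0l scale0r scaler0.
  by rewrite big1 ?scaler0// => j _; rewrite hform0l mulr0 mul0r scale0r.
by rewrite big1 ?scaler0// => j _; rewrite mxE scale0r.
Qed.

Lemma Eminus_lin0 x p : Eminus b x p (0 : V) = 0.
Proof.
rewrite /Eminus serexp_ann /ser1 ?if_same// => i;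
  by case: eqP => // _; rewrite heis_lin0 scaler0.
Qed.

Lemma Eminus_lat0 p v : Eminus b 0 p v = ser1 p v.
Proof.
rewrite /Eminus serexp_ann// => i;
  by case: eqP => // _; rewrite heis_hlat0 scaler0.
Qed.

Lemma Eplus_lat0 q v : Eplus b 0 q v = ser1 q v.
Proof.
rewrite /Eplus serexp_ann// => i;
  by case: eqP => // _; rewrite heis_hlat0 scaler0 oppr0.
Qed.

(** Annihilation operators kill [e^y], so only the constant term of the second
    exponential survives on the line spanned by [e^y]. *)
Lemma Eplus_e x q c y : Eplus b x q (c *: e_ F r y) = ser1 q (c *: e_ F r y).
Proof.
rewrite /Eplus serexp_ann// => -[|i] //=.
  by rewrite heis_lin0 scaler0 oppr0.
by rewrite [heis _ _ _ _]linearZ /= heis_epos !scaler0 oppr0.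
Qed.

Lemma Eplus_lin0 x q : Eplus b x q (0 : V) = 0.
Proof. by rewrite -(scale0r (e_ F r 0)) Eplus_e /ser1 scale0r if_same. Qed.

Lemma eop0 v : eop eps 0 v = v.
Proof.
have [_ _ _ eps0] := epsP.
rewrite /eop [in RHS](bvecE v); apply: eq_bigr => -[S y] _ /=.
by rewrite (eps0 y).1 add0r scale1r.
Qed.

Lemma zop0 s v : zop 0 s v = if s == 0 then v else 0.
Proof.
rewrite /zop eq_sym; case: eqP => s0.
  by rewrite [RHS](bvecE v); apply: eq_bigr => k _; rewrite lform0l s0 eqxx.
by apply: big1 => k _; rewrite lform0l ifF ?scaler0//; apply/eqP.
Qed.

(** For [x = 0] both exponentials are trivial and [z^0] is constant. *)
Lemma Ye0 n v : Ye b eps 0 n v = idfield n v.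
Proof.
rewrite /Ye (@fsum_single _ _ _ (0%N, 0%N)) => [|[p q] /= pq0].
  rewrite Eminus_lat0 Eplus_lat0 eop0 zop0 /ser1 /idfield /=.
  by congr (if _ then _ else _); apply/eqP/eqP; lia.
rewrite Eminus_lat0 Eplus_lat0 /ser1; case: eqP => // p0; case: eqP => // q0.
by rewrite p0 q0 in pq0.
Qed.

Lemma zop_e x s c y :
  zop x s (c *: e_ F r y) = if lform x y == s then c *: e_ F r y else 0.
Proof.
rewrite /zop linearZ /= /e_ linext_bvec /=.
by case: ifP => _; rewrite ?scaler0.
Qed.

Lemma eop_e x c y :
  eop eps x (c *: e_ F r y) = (c * (eps x y)%:~R) *: e_ F r (x + y).
Proof. by rewrite /eop linearZ /= /e_ linext_bvec scalerA. Qed.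

Lemma eop_lin0 x : eop eps x (0 : V) = 0.
Proof. exact: linear0. Qed.

Let Ye_term_out x n c y (p q : nat) : (n + lform x y + 1 + p%:Z != 0) || (q != 0%N) ->
  Eminus b x p (Eplus b x q (eop eps x (zop x (- n - 1 - p%:Z + q%:Z) (c *: e_ F r y)))) = 0.
Proof.
move=> pq; rewrite zop_e; case: ifPn => [/eqP xy|_].
  rewrite eop_e Eplus_e /ser1; case: eqP => [q0|_]; last exact: Eminus_lin0.
  by rewrite q0 orbF in pq; case/eqP: pq; rewrite xy q0; lia.
by rewrite eop_lin0 Eplus_lin0 Eminus_lin0.
Qed.

(** [Y(e^x,z) e^y] starts in degree [(x|y)]: its positive powers of [z] come from
    the creation operators, the negative ones act trivially on [e^y]. *)
Lemma Ye_e_out x n c y : 0 <= n + lform x y -> Ye b eps x n (c *: e_ F r y) = 0.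
Proof.
move=> nxy; apply: fsum0 => -[p q]; apply: Ye_term_out.
by apply/orP; left; apply/eqP; lia.
Qed.

Lemma Ye_e_lead x n c y : n + lform x y = -1 ->
  Ye b eps x n (c *: e_ F r y) = (c * (eps x y)%:~R) *: e_ F r (x + y).
Proof.
move=> nxy; rewrite /Ye (@fsum_single _ _ _ (0%N, 0%N)) => [|[p q] pq].
  rewrite zop_e ifT; last by apply/eqP => /=; lia.
  by rewrite eop_e Eplus_e /= /ser1 /Eminus serexp0E.
apply: Ye_term_out; rewrite -negb_and; apply: contraNN pq => /andP[].
by rewrite nxy addNr add0r => /eqP /= [->] /eqP ->.
Qed.

Lemma Ye_lin0 x n : Ye b eps x n (0 : V) = 0.
Proof.
apply: fsum0 => -[p q]; rewrite /zop [linext _ _]linear0 eop_lin0.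
by rewrite Eplus_lin0 Eminus_lin0.
Qed.

Lemma Yfock_e x n v : Yfock b eps (Fock mset0 x) n v = Ye b eps x n v.
Proof. by rewrite /Yfock /= enum_mset0. Qed.

Lemma Yfock1 i m x n v : Yfock b eps (Fock [mset (i, m)]%mset x) n v =
  nop (ddfield m (heis b (hvec F i))) (Ye b eps x) n v.
Proof. by rewrite /Yfock /= enum_msetn. Qed.

Lemma ddfield_lin0 m (A : opfield V) n : (forall k : int, A k 0 = 0) -> ddfield m A n 0 = 0.
Proof.
move=> A0; rewrite /ddfield; suff -> : iter m (@dfield _ V) A n 0 = 0 by rewrite scaler0.
elim: m n => [|m IHm] n /=; first exact: A0.
by rewrite /dfield IHm scaler0 oppr0.
Qed.

(** The field of [b_i(-m-1)1] is a normally ordered product with the identity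
    field, and [1/m! \partial^m] moves the mode of index [-m-1] to index [-1]. *)
Lemma Yfock_heis_m1 i m v :
  Yfock b eps (Fock [mset (i, m)]%mset 0) (-1) v = heis b (hvec F i) (Negz m) v.
Proof.
rewrite Yfock1 nop_idfield ?ddfield_m1// => [k|k w]; last exact: Ye0.
by apply: ddfield_lin0 => k'; exact: heis_lin0.
Qed.

(** The pole of order [m+1] of [\partial^m b_i(z)] on [e^y] compensates the zero
    of order [(x|y) = m+1] of [Y(e^x,z) e^y]. *)
Lemma Yfock_pole i m x y : lform x y = m.+1 ->
  Yfock b eps (Fock [mset (i, m)]%mset x) (-1) (e_ F r y) =
    ((-1) ^+ m * (lform (b i) y)%:~R * (eps x y)%:~R) *: e_ F r (x + y).
Proof.
move=> xy; rewrite Yfock1 /nop fsum0 ?add0r => [|j]; last first.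
  rewrite -[e_ F r y]scale1r Ye_e_out; last by rewrite xy; lia.
  by apply: ddfield_lin0 => j'; exact: heis_lin0.
(* In the second sum only [j = m] survives, through the zero mode of [b_i]. *)
rewrite (@fsum_single _ _ _ m) => [|j jm]; rewrite ddfield_pos.
  rewrite binn mulr1 subrr heis_e0 scalerA hform_hvec_hlat Ye_e_lead//.
  by rewrite xy; lia.
suff -> : ((-1) ^+ m * 'C(j, m)%:R) *: heis b (hvec F i) (j%:Z - m%:Z) (e_ F r y) = 0.
  exact: Ye_lin0.
have [jltm|mltj] := ltnP j m; first by rewrite bin_small// mulr0 scale0r.
have {}mltj : (m < j)%N by rewrite ltn_neqAle eq_sym jm mltj.
rewrite subzn 1?ltnW// -(ltn_predK (_ : 0 < j - m)%N) ?subn_gt0//.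
by rewrite heis_epos scaler0.
Qed.

End LatticeModes.

(** * The Virasoro element *)

Lemma perm_pairP (T : eqType) (s : seq T) x y :
  perm_eq s [:: x; y] -> s = [:: x; y] \/ s = [:: y; x].
Proof.
case: s => [|a s] sxy; first by have := perm_size sxy.
have := perm_mem sxy a; rewrite !inE eqxx => /esym /orP[] /eqP ay; subst a.
  by left; move: sxy; rewrite perm_cons => /perm_small_eq ->.
right; move: sxy; rewrite (perm_sym _ [:: x; y]) (perm_catC [:: x] [:: y]).
by rewrite perm_cons perm_sym => /perm_small_eq ->.
Qed.

Section Virasoro.
Variables (F : numFieldType) (L : evenLattice) (r : nat) (b : zbasis L r).
Variables (eps : L -> L -> int) (epsP : cocycle eps).
Variables (u : 'I_r -> cartan F r) (uP : orthonormal_basis b u).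
Local Notation V := (VL F L r).
Local Notation vac1 i m := (bvec F (Fock [mset (i, m)]%mset (0 : L))).
Implicit Types (i j l : 'I_r) (m : nat).

Lemma Ymode_bvec k n (v : V) : Ymode b eps (bvec F k) n v = Yfock b eps k n v.
Proof. exact: (linext_bvec (fun k => Yfock b eps k n v)). Qed.

(** An orthonormal family of full size reproduces every vector: a one-sided
    inverse of a square matrix is two-sided. *)
Lemma orthonormal_coord h j : \sum_i hform b h (u i) * u i 0 j = h 0 j.
Proof.
pose U := \matrix_(i, j) u i 0 j.
pose G : 'M[F]_r := \matrix_(i, j) (lform (b i) (b j))%:~R.
have hformM (x y : cartan F r) : hform b x y = (x *m G *m y^T) 0 0.
  rewrite /hform exchange_big mxE; apply: eq_bigr => k _; rewrite !mxE mulr_suml.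
  by apply: eq_bigr => l _; rewrite !mxE mulrAC.
have rowU i : row i U = u i by apply/rowP => k; rewrite !mxE.
have UGU : U *m (G *m U^T) = 1%:M.
  apply/matrixP => i k; rewrite [RHS]mxE -uP hformM -!rowU mulmxA.
  by rewrite -row_mul [LHS]mxE [RHS]mxE; apply: eq_bigr => l _; rewrite !mxE.
have := mulmx1C UGU => /(congr1 (fun M => (h *m M) 0 j)).
rewrite mulmx1 => <-; rewrite !mulmxA [RHS]mxE; apply: eq_bigr => i _.
rewrite hformM -(rowU i) [in RHS]mxE [X in _ * X]mxE; congr (_ * _).
by rewrite mxE; apply: eq_bigr => k _; rewrite !mxE.
Qed.

Lemma heis_annih i l m (p : nat) :
  heis b (hvec F i) p (vac1 l m) =
    if p == m.+1 then (m.+1%:R * hform b (hvec F i) (hvec F l)) *: e_ F r 0 else 0.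
Proof.
rewrite /heis linext_bvec; case: p => [|p] /=.
  by rewrite hlat0 hformC hform0l scale0r.
rewrite eqSS (bigD1 l)//= [X in _ + X]big1 => [|j /negPf jl]; last first.
  by rewrite msetnE xpair_eqE jl mulr0 scale0r.
rewrite msetnE xpair_eqE eqxx addr0 /=; case: eqP => [->|_]; last by rewrite mulr0 scale0r.
rewrite mulr1; congr (_ *: bvec F (Fock _ _)).
by apply/msetP => z; rewrite msetB1E msetnE mset0E; case: eqP.
Qed.

Lemma mset_pair_enum (T : choiceType) (x y : T) :
  perm_eq (x +` [mset y])%mset [:: x; y].
Proof.
suff -> : (x +` [mset y])%mset = seq_mset [:: x; y] by exact: perm_eq_seq_mset.
apply/msetP => z; rewrite mset_seqE mset1DE msetnE /= addn0 !(eq_sym z).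
by case: (y == z).
Qed.

(** The iterated normally ordered product follows some enumeration of the multiset
    of modes, of which nothing is known; the value is symmetric in [i] and [j], so
    the two possible orders agree. *)
Lemma Yfock_quadratic i j l m :
  Yfock b eps (Fock ((i, 0%N) +` [mset (j, 0%N)])%mset 0) 0 (vac1 l m) =
  (m.+1%:R * hform b (hvec F j) (hvec F l)) *: vac1 i m.+1 +
  (m.+1%:R * hform b (hvec F i) (hvec F l)) *: vac1 j m.+1.
Proof.
have dd0 (A : opfield V) n v : ddfield 0 A n v = A n v.
  by rewrite /ddfield fact0 invr1 scale1r.
have create i' c : heis b (hvec F i') (- m.+1%:Z - 1) (c *: e_ F r 0) = c *: vac1 i' m.+1.
  rewrite (_ : - m.+1%:Z - 1 = Negz m.+1); last by lia.
  by rewrite [LHS]linearZ /= heis_creation /= msetD0.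
pose B j' := nop (ddfield 0 (heis b (hvec F j'))) (Ye b eps 0).
have BE j' n v : B j' n v = heis b (hvec F j') n v.
  rewrite /B nop_idfield ?dd0// => [k|k w]; last exact: Ye0.
  by rewrite dd0 heis_lin0.
have key i' j' : nop (ddfield 0 (heis b (hvec F i'))) (B j') 0 (vac1 l m) =
  (m.+1%:R * hform b (hvec F j') (hvec F l)) *: vac1 i' m.+1 +
  (m.+1%:R * hform b (hvec F i') (hvec F l)) *: vac1 j' m.+1.
  rewrite /nop (@fsum_single _ _ _ m.+1) => [|p /negPf pm]; last first.
    by rewrite dd0 BE add0r heis_annih pm heis_lin0.
  rewrite (@fsum_single _ _ _ m.+1) => [|p /negPf pm]; last first.
    by rewrite dd0 BE heis_annih pm heis_lin0.
  rewrite !dd0 !BE add0r sub0r (addrC (-1)) !heis_annih eqxx.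
  by rewrite !create.
rewrite /Yfock /=.
have [->|->] := perm_pairP (mset_pair_enum (i, 0%N) (j, 0%N)); first exact: key.
by rewrite [RHS]addrC; exact: key.
Qed.

Lemma omegaE : omega b u =
  2%:R^-1 *: \sum_k \sum_i \sum_j (u k 0 i * u k 0 j) *:
    bvec F (Fock ((j, 0%N) +` [mset (i, 0%N)])%mset 0).
Proof.
rewrite /omega; congr (_ *: _); apply: eq_bigr => k _.
rewrite [heis b (u k) (-1) (e_ F r 0)]linext_bvec /= [LHS]linear_sum.
apply: eq_bigr => i _; rewrite [LHS]linearZ /= [heis _ _ _ _]linext_bvec /=.
rewrite scaler_sumr; apply: eq_bigr => j _.
by rewrite scalerA msetD0.
Qed.

(** Each summand [u_k(-1)^2] of [2 omega] contributes
    [2 (m+1) (u_k|b_l) u_k(-m-2)1], and orthonormality resums these vectors. *)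
Lemma Lm1_heis l m : Ymode b eps (omega b u) 0 (vac1 l m) = m.+1%:R *: vac1 l m.+1.
Proof.
(* [S] is one of the two terms of [Yfock_quadratic] summed against [2 omega]; the
   other one is [S] with the indices [i] and [j] exchanged. *)
pose S := \sum_k \sum_i \sum_j
  (u k 0 i * u k 0 j * (m.+1%:R * hform b (hvec F i) (hvec F l))) *: vac1 j m.+1.
have SE : S = m.+1%:R *: vac1 l m.+1.
  transitivity (\sum_j (m.+1%:R * hvec F l 0 j) *: vac1 j m.+1); last first.
    rewrite (bigD1 l)//= big1 ?addr0 => [|j /negPf jl]; rewrite !mxE eqxx.
      by rewrite eqxx mulr1.
    by rewrite jl mulr0 scale0r.
  rewrite /S (eq_bigr _ (fun k _ => exchange_big _ _ _ _ _ _)) exchange_big /=.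
  apply: eq_bigr => j _; rewrite -(orthonormal_coord (hvec F l)) mulr_sumr scaler_suml.
  apply: eq_bigr => k _; rewrite -scaler_suml; congr (_ *: _).
  rewrite hform_sumr !mulr_suml mulr_sumr; apply: eq_bigr => i _.
  by rewrite hformC; ring.
have : Ymode b eps (omega b u) 0 (vac1 l m) = 2%:R^-1 *: (S + S).
  rewrite omegaE; set f := fun k => Yfock b eps k 0 (vac1 l m).
  have fZ c w : linext f (c *: w) = c *: linext f w by exact: linearZ.
  have fsum (g : 'I_r -> V) : linext f (\sum_i g i) = \sum_i linext f (g i).
    exact: linear_sum.
  rewrite [LHS]fZ; congr (_ *: _).
  rewrite fsum /S -big_split; apply: eq_bigr => k _ /=.
  rewrite [X in _ = _ + X]exchange_big -big_split fsum; apply: eq_bigr => i _ /=.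
  rewrite -big_split fsum; apply: eq_bigr => j _ /=.
  rewrite fZ linext_bvec /f Yfock_quadratic.
  by rewrite scalerDr !scalerA [u k 0 j * u k 0 i]mulrC.
by move->; rewrite -SE -mulr2n -scaler_nat scalerA mulVf ?scale1r ?pnatr_eq0.
Qed.

End Virasoro.

(** * The space C_1 of a conic-type subalgebra *)

Section FockSpace.
Variables (F : fieldType) (L : evenLattice) (r : nat).
Local Notation V := (VL F L r).
Local Notation vaclabel := (Fock mset0 0 : fock_label L r).

Lemma msupp_bvec (k k' : fock_label L r) : k' \in msupp (bvec F k) -> k' = k.
Proof. by move/(fsubsetP msuppU_le); rewrite inE => /eqP. Qed.

Lemma subspace_bvec (S : set V) v :
  subspace S -> (forall k, k \in msupp v -> S (bvec F k)) -> S v.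
Proof.
by move=> SP Sv; rewrite (bvecE v); apply: subspace_sum => // k /Sv; apply: subspaceZ.
Qed.

Lemma VM_bvec (M : set L) k : M (fbase (k : fock_label L r)) -> VM M (bvec F k).
Proof. by move=> Mk k' /msupp_bvec ->. Qed.

Lemma VM_subspace (M : set L) : subspace (@VM F L r M).
Proof.
split=> [k|c v w vM wM k]; first by rewrite msupp0 inE.
move/(fsubsetP (msuppD_le _ _)); rewrite in_fsetU => /orP[|/wM//].
by move/(fsubsetP (msuppZ_le _ _)) => /vM.
Qed.

Lemma coef_eq0_subspace k : subspace [set v : V | v@_k = 0].
Proof.
split=> [|c v w /= v0 w0]; first by rewrite /= mcoeff0.
by rewrite mcoeffD mcoeffZ v0 w0 mulr0 addr0.
Qed.

Lemma fock_label_split (k : fock_label L r) :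
  fmodes k = mset0 \/ exists i m S, fmodes k = ((i, m) +` S)%mset.
Proof.
have [k0|[p pk]] := fset_0Vmem (finsupp (fmodes k)).
  left; apply/msetP => p; rewrite mset0E; apply/eqP.
  by rewrite -[_ == _]negbK -mem_finsupp k0 inE.
right; case: p pk => i m pk; exists i, m, (fmodes k `\ (i, m))%mset.
by rewrite msetB1K// -msuppE.
Qed.

Lemma wt_vac : wt vaclabel = 0.
Proof. by rewrite /wt /= enum_mset0 big_nil lform0l. Qed.

Lemma wt_ge1 (k : fock_label L r) : k != vaclabel -> 1 <= wt k.
Proof.
case: k => S x kvac; rewrite /wt /=.
have x2 := lform_even x.
have [x0|x0] := eqVneq x 0; last first.
  by have := lform_gt0 x0; lia.
rewrite x0 lform0l div0z addr0.
have [/= S0|[i [m [T /= ST]]]] := fock_label_split (Fock S x).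
  by rewrite S0 x0 eqxx in kvac.
rewrite (big_rem (i, m)) /=; last by rewrite -mem_undup (perm_mem (perm_undup_mset _)) msuppE ST mset1D1.
by rewrite addSn.
Qed.

End FockSpace.

Section ConicC1.
Variables (F : numFieldType) (L : evenLattice) (r : nat) (b : zbasis L r).
Variables (eps : L -> L -> int) (epsP : cocycle eps).
Variables (u : 'I_r -> cartan F r) (uP : orthonormal_basis b u).
Local Notation X := (lattice_subVOA b eps u (conic b)).
Local Notation vaclabel := (Fock mset0 0 : fock_label L r).
Local Notation vac1 i m := (bvec F (Fock [mset (i, m)]%mset (0 : L))).
Implicit Types (x y : L) (i : 'I_r) (m : nat) (k : fock_label L r).

Lemma conic0 : conic b 0.
Proof. by exists (fun=> 0%N); rewrite big1. Qed.

Lemma vplus_bvec k : conic b (fbase k) -> k != vaclabel -> @vplus F X (bvec F k).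
Proof.
move=> kC kvac; apply: sub_lspan; exists (wt k); first exact: wt_ge1.
by split=> [|k' /msupp_bvec ->//]; exact: VM_bvec.
Qed.

(** Positive definiteness enters here: no [e^x] with [x] nonzero has weight 0. *)
Lemma conic_CFT : @CFT_type F X.
Proof.
have vac_sub : @subspace F X [set v | exists c, v = c *: e_ F r (0 : L)].
  split=> [|c _ _ [d ->] [d' ->]]; first by exists 0; rewrite scale0r.
  by exists (c * d + d'); rewrite scalerA scalerDl.
have gr0E : vgr X 0 = [set v | exists c, v = c *: e_ F r (0 : L)].
  apply/seteqP; split=> [v [vC v0]|_ [c ->]].
    apply: (subspace_bvec vac_sub) => k /v0 k0; exists 1; rewrite scale1r.
    have [->//|/wt_ge1] := eqVneq k vaclabel.
    by rewrite k0.
  split=> [k|k] /(fsubsetP (msuppZ_le _ _)) /msupp_bvec ->.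
    exact: conic0.
  exact: wt_vac.
split.
- rewrite gr0E; apply/seteqP; split=> [_ [c ->]|].
    by apply: subspaceZ; [exact: lspan_subspace | exact: sub_lspan].
  by apply: lspan_min => // _ ->; exists 1; rewrite scale1r.
- have vplusP : @subspace F X (@vplus F X) by exact: lspan_subspace.
  rewrite gr0E; apply/seteqP; split=> [v vC|_ [_ [c ->] [w wP <-]]].
    apply: (subspace_bvec (sumset_subspace vac_sub vplusP)) => k /vC kC.
    have [->|kvac] := eqVneq k vaclabel.
      by apply: sub_sumsetl; [case: vplusP | exists 1; rewrite scale1r].
    by apply: sub_sumsetr; [case: vac_sub | exact: vplus_bvec].
  have VP := VM_subspace F r (conic b).
  apply: (subspaceD VP); first by apply: (subspaceZ _ VP); exact: VM_bvec conic0.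
  by apply: lspan_min wP => // v [n _ []].
- rewrite gr0E; apply/seteqP; split=> [_ [[c ->] cP]|_ ->]; last first.
    by split; [case: vac_sub | case: (lspan_subspace (\bigcup_(n in [set n | 1 <= n]) vgr X n))].
  have : (c *: e_ F r (0 : L))@_vaclabel = 0.
    apply: (lspan_min (coef_eq0_subspace F vaclabel)) cP => v [n /= n1 [_ vn]] /=.
    apply: mcoeff_outdom; apply: contraL n1 => /vn <-.
    by rewrite wt_vac.
  by rewrite mcoeffZ mcoeffUU mulr1 => ->; rewrite /= scale0r.
Qed.

Lemma C1_subspace : @subspace F X (@C1 F X).
Proof. by apply: sumset_subspace; exact: lspan_subspace. Qed.

Lemma C1_mode (a c : X) : @vplus F X a -> @vplus F X c ->
  @C1 F X (Ymode b eps a (-1) c).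
Proof.
move=> aP cP; apply: sub_sumsetl; first by case: (lspan_subspace [set @Lm1 F X v | v in @vplus F X]).
by apply: sub_lspan; exists a => //; exists c.
Qed.

Lemma C1_Lm1 (v : X) : @vplus F X v -> @C1 F X (Ymode b eps (omega b u) 0 v).
Proof.
move=> vP; apply: sub_sumsetr; last by apply: sub_lspan; exists v.
by case: (lspan_subspace [set @vmode F X a (-1) c | a in @vplus F X & c in @vplus F X]).
Qed.

Lemma mset1_neq0 (T : choiceType) (p : T) : [mset p]%mset <> mset0.
Proof. by move/msetP/(_ p); rewrite msetnE mset0E eqxx. Qed.

Lemma C1_heis k i m : conic b (fbase k) -> k != vaclabel ->
  @C1 F X (bvec F (Fock ((i, m) +` fmodes k)%mset (fbase k))).
Proof.
move=> kC kvac; rewrite -(@heis_creation F L r b) -(Yfock_heis_m1 b epsP) -Ymode_bvec.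
apply: C1_mode; apply: vplus_bvec => //; first exact: conic0.
by apply/eqP => -[] /mset1_neq0.
Qed.

Lemma C1_heis_vac i m : @C1 F X (vac1 i m.+1).
Proof.
have := @C1_Lm1 (vac1 i m); rewrite (Lm1_heis epsP uP) => C1im.
rewrite -[vac1 _ _](@scalerK _ _ (m.+1%:R)) ?pnatr_eq0//.
apply: subspaceZ; first exact: C1_subspace.
apply: C1im; apply: vplus_bvec; first exact: conic0.
by apply/eqP => -[] /mset1_neq0.
Qed.

(** If [(x|y) = 0] then [e^(x+y)] is, up to sign, the leading coefficient
    [e^x_(-1) e^y].  If [(x|y) = s > 0] the leading coefficient sits in degree [s],
    and replacing [e^x] by [b_i(-s) e^x], with [(b_i|y)] nonzero, brings it
    back to degree 0. *)
Lemma C1_e_add x y : conic b x -> conic b y -> x != 0 -> y != 0 ->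
  0 <= lform x y -> @C1 F X (e_ F r (x + y)).
Proof.
move=> xC yC x0 y0 xy.
have vacN S z : z != 0 -> Fock S z != vaclabel.
  by apply: contraNneq => -[_ ->].
have epsU : (eps x y)%:~R != 0 :> F.
  by have [+ _ _ _] := epsP => /(_ x y) [] ->; rewrite intr_eq0.
have done_ c S : c != 0 ->
    Ymode b eps (bvec F (Fock S x)) (-1) (e_ F r y) = c *: e_ F r (x + y) ->
    @C1 F X (e_ F r (x + y)).
  move=> c0 E; rewrite -[e_ _ _ _](scalerK c0) -E.
  apply: subspaceZ; first exact: C1_subspace.
  by apply: C1_mode; apply: vplus_bvec => //; exact: vacN.
case xyE : (lform x y) xy => [[|m]|//] _.
  apply: (done_ (eps x y)%:~R mset0) => //.
  rewrite Ymode_bvec Yfock_e -[e_ F r y]scale1r Ye_e_lead ?mul1r//.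
  by rewrite xyE addr0.
(* Otherwise [y] would be orthogonal to the basis, hence to [x]. *)
have [i iy] : exists i, lform (b i) y != 0.
  apply: contrapT => /forallNP iy; move: xyE.
  rewrite -(zcoordK b x) lform_suml big1// => i _.
  by rewrite lformMzl; have /negP/negPn/eqP -> := iy i; rewrite mul0rz.
apply: (done_ ((-1) ^+ m * (lform (b i) y)%:~R * (eps x y)%:~R) [mset (i, m)]%mset).
  by rewrite !mulf_neq0// ?signr_eq0// intr_eq0.
by rewrite Ymode_bvec Yfock_pole.
Qed.

(** Modulo [C_1] there remain the vacuum, the [b_i(-1)1] and the [e^x] for [x] with
    no decomposition; the hypothesis confines the latter to a finite box. *)
Theorem C1_cofinite_of_decomposition (N : nat) :
  (forall c : 'I_r -> nat, (exists i, (N <= c i)%N) -> exists x y,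
     [/\ conic b x, conic b y, x != 0 /\ y != 0, 0 <= lform x y &
         x + y = \sum_(i < r) b i *+ c i]) ->
  @C1_cofinite F X.
Proof.
move=> decomp; split; first exact: conic_CFT.
pose esum (c : {ffun 'I_r -> 'I_N}) := \sum_(i < r) b i *+ c i.
pose s : seq X := e_ F r (0 : L) ::
  [seq vac1 i 0 | i <- enum 'I_r] ++ [seq e_ F r (esum c) | c <- enum {ffun 'I_r -> 'I_N}].
exists s.
  move=> v /=; rewrite inE mem_cat => /or3P[/eqP->|/mapP[i _ ->]|/mapP[c _ ->]];
    apply: VM_bvec; [exact: conic0 | exact: conic0 |].
  by exists (fun i => nat_of_ord (c i)).
have sP : @subspace F X (sumset (lspan [set` s]) (@C1 F X)).
  by apply: sumset_subspace; [exact: lspan_subspace | exact: C1_subspace].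
have inC1 : @C1 F X `<=` sumset (lspan [set` s]) (@C1 F X).
  by apply: sub_sumsetr; case: (lspan_subspace [set` s]).
have ins v : v \in s -> sumset (lspan [set` s]) (@C1 F X) v.
  by move=> vs; apply: sub_sumsetl; [case: C1_subspace | exact: sub_lspan].
move=> v vC; apply: (subspace_bvec sP) => -[S x] /vC /= xC.
have [/= ->|[i [m [T /= ->]]]] := fock_label_split (Fock S x).
  case: xC => c xE.
  have [/decomp [y [z [yC zC [y0 z0] yz yzE]]]|cN] := pselect (exists i, (N <= c i)%N).
    by apply: inC1; rewrite xE -yzE; exact: C1_e_add.
  have ltcN i : (c i < N)%N by rewrite ltnNge; apply/negP => Nci; apply: cN; exists i.
  apply: ins; rewrite inE mem_cat; apply/or3P/Or33/mapP.
  exists [ffun i => Ordinal (ltcN i)]; first by rewrite mem_enum.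
  rewrite /e_ xE; congr (bvec F (Fock _ _)).
  by apply: eq_bigr => i _; rewrite ffunE.
have [[-> ->]|kvac] := eqVneq (Fock T x) vaclabel; last first.
  by apply: inC1; exact: (@C1_heis (Fock T x)).
rewrite msetD0; case: m => [|m]; last by apply: inC1; exact: C1_heis_vac.
apply: ins; rewrite inE mem_cat; apply/or3P/Or32/mapP.
by exists i => //; rewrite mem_enum.
Qed.

End ConicC1.

(** * Decompositions in rank one and two *)

Section Decomposition.
Variables (L : evenLattice) (r : nat) (b : zbasis L r).
Implicit Types c d : 'I_r -> nat.

Lemma conic_sum_neq0 c i : c i != 0%N -> \sum_(j < r) b j *+ c j != 0.
Proof.
apply: contra_neq => c0.
have zK d : zcoord b (\sum_(j < r) b j *+ d j) i = d i.
  exact: (zvecK b (fun j => Posz (d j))).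
have := zK c; rewrite c0; have := zK (fun=> 0%N).
by rewrite big1// => -> [].
Qed.

Lemma conic_sumD c d :
  \sum_(j < r) b j *+ c j + \sum_(j < r) b j *+ d j =
  \sum_(j < r) b j *+ (c j + d j).
Proof. by rewrite -big_split; apply: eq_bigr => j _; rewrite mulrnDr. Qed.

End Decomposition.

(** The form at the two halves [x], [y] of [z = x + y] is a quarter of
    [(z|z) - (x-y|x-y)]: here [x - y] has coordinates 0 or 1, hence norm at most
    [2(l+k)], whereas [(z|z)] is bounded below by a multiple of the square of each
    coordinate because the discriminant is positive. *)
Lemma halves_form_ge0 (n k l : int) (p q : nat) :
  0 <= n -> 0 < k -> 0 < l -> n ^+ 2 < 4 * l * k ->
  4 * k * l * (l + k) <= p%:Z \/ 4 * k * l * (l + k) <= q%:Z ->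
  0 <= 2 * l * (p./2%:Z * (uphalf p)%:Z) + 2 * k * (q./2%:Z * (uphalf q)%:Z)
       - n * (p./2%:Z * (uphalf q)%:Z + q./2%:Z * (uphalf p)%:Z).
Proof.
move=> n0 k0 l0 D0 pq.
set x := p./2%:Z; set y := q./2%:Z; set x' := (uphalf p)%:Z; set y' := (uphalf q)%:Z.
have [e x'E e01] : exists2 e : int, x' = x + e & e = 0 \/ e = 1.
  by exists (odd p)%:Z; [rewrite /x' /x; lia | case: (odd p); [right|left]].
have [d y'E d01] : exists2 d : int, y' = y + d & d = 0 \/ d = 1.
  by exists (odd q)%:Z; [rewrite /y' /y; lia | case: (odd q); [right|left]].
pose A := 2 * x + e; pose B := 2 * y + d.
have pA : p%:Z = A by move: x'E; rewrite /A /x' /x; lia.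
have qB : q%:Z = B by move: y'E; rewrite /B /y' /y; lia.
have ed : 2 * l * e ^+ 2 - 2 * n * (e * d) + 2 * k * d ^+ 2 <= 2 * (l + k).
  by case: e01 => ->; case: d01 => ->; lia.
pose Q := 2 * l * A ^+ 2 - 2 * n * (A * B) + 2 * k * B ^+ 2.
have QA : 2 * k * Q = (2 * k * B - n * A) ^+ 2 + (4 * l * k - n ^+ 2) * A ^+ 2.
  by rewrite /Q; ring.
have QB : 2 * l * Q = (2 * l * A - n * B) ^+ 2 + (4 * l * k - n ^+ 2) * B ^+ 2.
  by rewrite /Q; ring.
pose T := 4 * k * l * (l + k).
have T1 : 1 <= T by rewrite -gtz0_ge1 !mulr_gt0// addr_gt0.
have Tl : 2 * k * (2 * (l + k)) <= T.
  rewrite (_ : T = 2 * k * (2 * (l + k)) * l); last by rewrite /T; ring.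
  by rewrite ler_peMr -?gtz0_ge1// !mulr_ge0 ?addr_ge0 ?(ltW k0) ?(ltW l0).
have Tk : 2 * l * (2 * (l + k)) <= T.
  rewrite (_ : T = 2 * l * (2 * (l + k)) * k); last by rewrite /T; ring.
  by rewrite ler_peMr -?gtz0_ge1// !mulr_ge0 ?addr_ge0 ?(ltW k0) ?(ltW l0).
have large (C : int) : T <= C -> T <= C ^+ 2.
  move=> TC; have C1 := le_trans T1 TC.
  by rewrite expr2 (le_trans TC)// ler_peMr// (le_trans _ C1).
have discr (C : int) : C ^+ 2 <= (4 * l * k - n ^+ 2) * C ^+ 2.
  by rewrite ler_peMl ?sqr_ge0// -gtz0_ge1 subr_gt0.
have Qge : 2 * (l + k) <= Q.
  case: pq => [pN|qN].
    have /large TA : T <= A by rewrite -pA.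
    rewrite -(ler_pM2l (_ : 0 < 2 * k)) ?mulr_gt0// (le_trans Tl)// QA.
    by rewrite (le_trans TA)// (le_trans (discr A))// lerDr sqr_ge0.
  have /large TB : T <= B by rewrite -qB.
  rewrite -(ler_pM2l (_ : 0 < 2 * l)) ?mulr_gt0// (le_trans Tk)// QB.
  by rewrite (le_trans TB)// (le_trans (discr B))// lerDr sqr_ge0.
rewrite -(pmulr_rge0 _ (_ : 0 < 4))// x'E y'E.
rewrite (_ : 4 * _ = Q - (2 * l * e ^+ 2 - 2 * n * (e * d) + 2 * k * d ^+ 2)).
  by rewrite subr_ge0 (le_trans ed).
by rewrite /Q /A /B; ring.
Qed.

Lemma sum_ord2 (V : nmodType) (f : 'I_2 -> V) : \sum_(i < 2) f i = f 0 + f 1.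
Proof. by rewrite big_ord_recl big_ord1; congr (f _ + f _); apply: val_inj. Qed.

Lemma conic_C1_cofinite_rank1 (F : numFieldType) (L : evenLattice) (b : zbasis L 1)
    (eps : L -> L -> int) (u : 'I_1 -> cartan F 1) :
  cocycle eps -> orthonormal_basis b u ->
  C1_cofinite (lattice_subVOA b eps u (conic b)).
Proof.
move=> epsP uP; apply: (C1_cofinite_of_decomposition epsP uP (N := 2)) => c [i c2].
rewrite (ord1 i) in c2.
exists (\sum_(j < 1) b j *+ 1), (\sum_(j < 1) b j *+ (c j).-1); split.
- by exists (fun=> 1%N).
- by exists (fun j => (c j).-1).
- split; first exact: (@conic_sum_neq0 _ _ b (fun=> 1%N) 0).
  by apply: (@conic_sum_neq0 _ _ b (fun j => (c j).-1) 0); lia.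
- rewrite !big_ord1 lformMnl lformMnr mulr1n mulrn_wge0//.
  by have [->|/lform_gt0/ltW//] := eqVneq (b ord0) 0; rewrite lform0l.
- rewrite (conic_sumD b (fun=> 1%N)) !big_ord1; congr (_ *+ _).
  by rewrite add1n prednK// (ltn_trans _ c2).
Qed.

Lemma conic_C1_cofinite_rank2 (F : numFieldType) (L : evenLattice) (b : zbasis L 2)
    (eps : L -> L -> int) (u : 'I_2 -> cartan F 2) (n k l : int) :
  cocycle eps -> orthonormal_basis b u ->
  lform (b 0) (b 1) = - n -> lform (b 1) (b 1) = 2 * k -> lform (b 0) (b 0) = 2 * l ->
  0 <= n -> 0 < k -> 0 < l -> n ^+ 2 < 4 * l * k ->
  C1_cofinite (lattice_subVOA b eps u (conic b)).
Proof.
move=> epsP uP b01 b11 b00 n0 k0 l0 D0.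
(* The summand 2 keeps both halves of [c i] nonzero. *)
pose N := (`|(4 * k * l * (l + k))%R|%N + 2)%N.
apply: (C1_cofinite_of_decomposition epsP uP (N := N)) => c [i ciN].
have c2 : (2 <= c i)%N by rewrite (leq_trans _ ciN)// leq_addl.
have ciT : 4 * k * l * (l + k) <= (c i)%:Z by rewrite /N in ciN; lia.
exists (\sum_(j < 2) b j *+ (c j)./2), (\sum_(j < 2) b j *+ uphalf (c j)); split.
- by exists (fun j => (c j)./2).
- by exists (fun j => uphalf (c j)).
- split; first by apply: (@conic_sum_neq0 _ _ b (fun j => (c j)./2) i); lia.
  by apply: (@conic_sum_neq0 _ _ b (fun j => uphalf (c j)) i); lia.
- have MnE (a : int) (m : nat) : a *+ m = a * m%:Z by rewrite -mulr_natr natz.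
  rewrite !sum_ord2; move: (b 0) (b 1) b01 b11 b00 => x y xy yy xx.
  rewrite !lformDl !lformDr !lformMnl !lformMnr (lformC y x) xy yy xx !MnE.
  have cT : 4 * k * l * (l + k) <= (c 0)%:Z \/ 4 * k * l * (l + k) <= (c 1)%:Z.
    have [i0|i1] : i = 0 \/ i = 1.
    + by case: i {ciN c2 ciT} => -[|[|m]] im //; [left|right]; apply: val_inj.
    + by left; rewrite -i0.
    + by right; rewrite -i1.
  apply: etrans (halves_form_ge0 n0 k0 l0 D0 cT); congr (0 <= _).
  by ring.
- rewrite conic_sumD; apply: eq_bigr => j _; congr (_ *+ _).
  by rewrite uphalf_half addnCA addnn odd_double_half.
Qed.

Theorem theoremA (R : realType) :
  (forall (L : evenLattice) (b : zbasis L 1) (eps : L -> L -> int)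
          (u : 'I_1 -> cartan R[i] 1),
     cocycle eps -> orthonormal_basis b u ->
     C1_cofinite (lattice_subVOA b eps u (conic b)))
  /\
  (forall (L : evenLattice) (b : zbasis L 2) (eps : L -> L -> int)
          (u : 'I_2 -> cartan R[i] 2) (n k l : int),
     cocycle eps -> orthonormal_basis b u ->
     lform (b 0) (b 1) = - n ->
     lform (b 1) (b 1) = 2 * k ->
     lform (b 0) (b 0) = 2 * l ->
     1 <= n -> l <= k -> 1 <= l ->
     n ^+ 2 + l ^+ 2 - 4 * l * k <= 0 ->
     C1_cofinite (lattice_subVOA b eps u (conic b))).

Proof.
split=> [L b eps u epsP uP|L b eps u n k l epsP uP b01 b11 b00 n1 lk l1 D].
  exact: conic_C1_cofinite_rank1.
have l0 : 0 < l by rewrite gtz0_ge1.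
apply: (conic_C1_cofinite_rank2 epsP uP b01 b11 b00) => //.
- exact: le_trans n1.
- exact: lt_le_trans lk.
- rewrite -subr_lt0; apply: lt_le_trans D.
  by rewrite ltrD2r ltrDl exprn_gt0.
Qed.
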